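(* Consider $\mathbb{R}^7$ with coordinates $(x_1,y_1,x_2,y_2,x_3,y_3,z)$ equipped with the pseudo-Riemannian metric of signature $(4,3)$ $$g=\sum_{i=1}^3\big(H_i\,\mathrm{d}x_i\otimes\mathrm{d}x_i+e^{K_i}\mathrm{d}x_i\odot\mathrm{d}y_i\big)+e^F\mathrm{d}z\otimes\mathrm{d}z$$ for arbitrary functions $H_1,H_2,H_3,K_1,K_2,K_3,F\in C^\infty(\mathbb{R}^7)$. Let $A\in\Gamma(T^*\mathbb{R}^7\otimes\Lambda^2T^*\mathbb{R}^7)$ and let $\varepsilon:\mathbb{R}^7\to\mathbb{R}^8$ be an isotropic and irreducible spinor parallel with respect to $\nabla^{g,A}$ and whose associated triple of one-forms is $$\vartheta=e^{K_1}\mathrm{d}x_1,\qquad\theta=e^{K_2}\mathrm{d}x_2,\qquad\eta=e^{K_3}\mathrm{d}x_3.$$ Then $$A(\partial_{y_i},\partial_{y_j},\partial_z)=0,\qquad A(\partial_{y_i},\partial_{y_j},\partial_{y_k})=0$$ for every $i,j,k=1,2,3$.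
   Context: Here $\mathrm{d}x_i\odot\mathrm{d}y_i=\mathrm{d}x_i\otimes\mathrm{d}y_i+\mathrm{d}y_i\otimes\mathrm{d}x_i$, so that $g(\partial_{x_i},\partial_{y_i})=e^{K_i}$. $\nabla^{g,A}=\nabla^g+A$ is the metric connection with contorsion $A$, where $\nabla^g$ is the Levi-Civita connection; on one-forms $\nabla^{g,A}_v\vartheta=\nabla^g_v\vartheta+A(v,\vartheta^\sharp,\cdot)$. It lifts to the spinor bundle (same symbol); $\varepsilon$ is parallel with respect to $\nabla^{g,A}$ if $\nabla^{g,A}\varepsilon=0$. Irreducible spinors are sections of an irreducible real spinor bundle $S$ of $(\mathbb{R}^7,g)$ (functions $\mathbb{R}^7\to\mathbb{R}^8$ in a trivialization), i.e. of a bundle of irreducible real modules over the Clifford bundle $\mathrm{Cl}(T^*\mathbb{R}^7,g^* )\cong(\Lambda T^*\mathbb{R}^7,\diamond)$, $\theta\diamond\alpha=\theta\wedge\alpha+\iota_{\theta^\sharp}\alpha$, with Clifford action $\Gamma$, in which the volume form $\nu$ acts as $l\,\mathrm{Id}$, $l\in\{\pm1\}$, equipped with an admissible pairing $\mathscr{B}$ (non-degenerate symmetric with $\mathscr{B}(\Gamma(x)\varepsilon_1,\varepsilon_2)=\mathscr{B}(\varepsilon_1,\Gamma((\pi\circ\tau)(x))\varepsilon_2)$, $\pi=(-1)^k$, $\tau=(-1)^{\binom k2}$ on $k$-forms). A spinor is isotropic if $\mathscr{B}(\varepsilon,\varepsilon)=0$. With $\Lambda^<=\bigoplus_{k=0}^3\Lambda^k$,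 the map $\Psi^<_\Gamma:\Lambda^<T^*\mathbb{R}^7\to\mathrm{End}(S)$, $\alpha\mapsto\Gamma(\frac12(\alpha+l\nu\diamond\alpha))$, is an isomorphism, and the square of $\varepsilon$ is $(\Psi^<_\Gamma)^{-1}(\mu\,\varepsilon\otimes\mathscr{B}(-,\varepsilon))$ for a sign $\mu\in\{\pm1\}$. The statement that $\varepsilon$ has associated triple $(\vartheta,\theta,\eta)$ means that, for some sign $\mu$, its square is $\vartheta\wedge\theta\wedge\eta$. *)

(* Defs.v *)
From HB Require Import structures.
From mathcomp Require Import all_boot all_order all_algebra all_fingroup.
From mathcomp Require Import all_classical all_reals all_analysis.

Set Implicit Arguments.
Unset Strict Implicit.
Unset Printing Implicit Defensive.

Import Order.TTheory GRing.Theory Num.Theory.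
Import numFieldNormedType.Exports.

Local Open Scope ring_scope.

Definition evec (R : realType) (n : nat) (i : 'I_n) : 'rV[R]_n := delta_mx 0 i.

Definition partial (R : realType) (n : nat) (i : 'I_n.+1)
    (f : 'rV[R]_n.+1 -> R) : 'rV[R]_n.+1 -> R :=
  fun x => 'D_(evec R i) f x.

Fixpoint Ck (R : realType) (n k : nat) (f : 'rV[R]_n.+1 -> R) : Prop :=
  continuous f /\
  if k is k'.+1 then
    forall i : 'I_n.+1,
      (forall x, derivable f x (evec R i)) /\ Ck k' (partial i f)
  else True.

Definition smooth (R : realType) (n : nat) (f : 'rV[R]_n.+1 -> R) : Prop :=
  forall k : nat, Ck k f.

Definition smooth_mx (R : realType) (n p q : nat)
    (M : 'rV[R]_n.+1 -> 'M[R]_(p, q)) : Prop :=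
  forall i j, smooth (fun x => M x i j).

Definition derive_mx (R : realType) (n p q : nat) (v : 'rV[R]_n.+1)
    (M : 'rV[R]_n.+1 -> 'M[R]_(p, q)) (x : 'rV[R]_n.+1) : 'M[R]_(p, q) :=
  \matrix_(i, j) 'D_v (fun y => M y i j) x.

(* Vectors and covectors are rows of components in the coordinate (co)basis.
   A polyform is its family of coefficients on the basis
   dx_I = dx_{i_1} /\ ... /\ dx_{i_k}, for I = {i_1 < ... < i_k}. *)

Definition polyform (R : realType) (n : nat) : Type :=
  {ffun {set 'I_n} -> R^o}.

Definition basis_form (R : realType) (n : nat) (I : {set 'I_n}) :
    polyform R n :=
  [ffun J : {set 'I_n} => (J == I)%:R].

Definition one_form (R : realType) (n : nat) (t : 'rV[R]_n) : polyform R n :=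
  \sum_(i < n) t 0 i *: basis_form R [set i].

Definition vdot (R : realType) (n : nat) (t v : 'rV[R]_n) : R :=
  (t *m v^T) 0 0.

(* dx_I /\ dx_J = shuffle_sign I J * dx_(I :|: J) for disjoint I and J. *)
Definition shuffle_sign (R : realType) (n : nat) (I J : {set 'I_n}) : R :=
  (-1) ^+ #|[set p in finset.setX I J | (p.2 < p.1)%N]|.

Definition wedge (R : realType) (n : nat) (a b : polyform R n) :
    polyform R n :=
  [ffun K : {set 'I_n} =>
     \sum_(I : {set 'I_n} | I \subset K)
        shuffle_sign R I (K :\: I) * a I * b (K :\: I)].

Definition contract (R : realType) (n : nat) (v : 'rV[R]_n)
    (a : polyform R n) : polyform R n :=
  [ffun J : {set 'I_n} =>
     \sum_(i < n | i \notin J)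
        v 0 i * shuffle_sign R [set i] J * a (i |: J)].

Definition flat (R : realType) (n : nat) (G : 'M[R]_n) (v : 'rV[R]_n) :
    'rV[R]_n := v *m G.

Definition sharp (R : realType) (n : nat) (G : 'M[R]_n) (t : 'rV[R]_n) :
    'rV[R]_n := t *m invmx G.

(* Clifford product of a one-form with a polyform. *)
Definition cmul1 (R : realType) (n : nat) (G : 'M[R]_n) (t : 'rV[R]_n)
    (a : polyform R n) : polyform R n :=
  wedge (one_form t) a + contract (sharp G t) a.

(* The Clifford product on polyforms, i.e. the associative product extending
   cmul1: dx_I acts as the antisymmetrization of the operators cmul1 dx_i. *)
Definition cmul (R : realType) (n : nat) (G : 'M[R]_n) (a b : polyform R n) :
    polyform R n :=
  \sum_(I : {set 'I_n})
    (a I / (#|I|)`!%:R) *: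
      \sum_(s : 'S_#|I|)
        ((-1) ^+ s : R) *:
          foldr (fun k c => cmul1 G (evec R (enum_val (s k))) c) b
                (enum 'I_#|I|).

(* Volume form of the standard orientation; the opposite orientation amounts to
   changing vol_sign in spinor_bundle below. *)
Definition vol_form (R : realType) (n : nat) (G : 'M[R]_n) : polyform R n :=
  Num.sqrt `|\det G| *: basis_form R [set: 'I_n].

(* pi o tau, where pi = (-1)^k and tau = (-1)^C(k,2) on k-forms. *)
Definition pi_tau (R : realType) (n : nat) (a : polyform R n) :
    polyform R n :=
  [ffun I : {set 'I_n} => (-1) ^+ (#|I| + 'C(#|I|, 2)) * a I].

Definition lower_form (R : realType) (n : nat) (a : polyform R n) : Prop :=
  forall I : {set 'I_n}, (n < 2 * #|I|)%N -> a I = 0.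

(* christoffel g x k i j is Gamma^k_ij. *)
Definition christoffel (R : realType) (n : nat)
    (g : 'rV[R]_n.+1 -> 'M[R]_n.+1) (x : 'rV[R]_n.+1)
    (k i j : 'I_n.+1) : R :=
  2^-1 * \sum_(l < n.+1) invmx (g x) k l *
    (partial i (fun y => g y j l) x + partial j (fun y => g y i l) x
     - partial l (fun y => g y i j) x).

Definition nabla_LC (R : realType) (n : nat)
    (g : 'rV[R]_n.+1 -> 'M[R]_n.+1) (v : 'rV[R]_n.+1)
    (t : 'rV[R]_n.+1 -> 'rV[R]_n.+1) (x : 'rV[R]_n.+1) : 'rV[R]_n.+1 :=
  derive_mx v t x -
  \row_j \sum_i \sum_k v 0 i * christoffel g x k i j * t x 0 k.

(* A tensor A in T* (x) T* (x) T* has components A x i j k. *)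
Definition tensor3 (R : realType) (n : nat) (A : 'I_n -> 'M[R]_n)
    (u v w : 'rV[R]_n) : R :=
  \sum_i u 0 i * (v *m A i *m w^T) 0 0.

Definition contorsion (R : realType) (n : nat)
    (A : 'rV[R]_n.+1 -> 'I_n.+1 -> 'M[R]_n.+1) : Prop :=
  (forall i, smooth_mx (fun x => A x i)) /\
  (forall x i, (A x i)^T = - A x i).

(* nabla_v t = nabla^g_v t + A(v, t^sharp, -) on one-forms t. *)
Definition nabla (R : realType) (n : nat)
    (g : 'rV[R]_n.+1 -> 'M[R]_n.+1)
    (A : 'rV[R]_n.+1 -> 'I_n.+1 -> 'M[R]_n.+1) (v : 'rV[R]_n.+1)
    (t : 'rV[R]_n.+1 -> 'rV[R]_n.+1) (x : 'rV[R]_n.+1) : 'rV[R]_n.+1 :=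
  nabla_LC g v t x +
  \row_j tensor3 (A x) v (sharp (g x) (t x)) (evec R j).

(* A bundle of irreducible real modules over the Clifford bundle of the cometric
   with volume form acting as vol_sign, in an arbitrary global trivialization
   R^7 x R^8; [pairing x] is the Gram matrix of the admissible pairing. *)
Record spinor_bundle (R : realType) (g : 'rV[R]_7 -> 'M[R]_7) := SpinorBundle {
  cliff : 'rV[R]_7 -> polyform R 7 -> 'M[R]_8;
  pairing : 'rV[R]_7 -> 'M[R]_8;
  vol_sign : R;
  cliff_smooth : forall I, smooth_mx (fun x => cliff x (basis_form R I));
  cliff_linear : forall x, linear (cliff x);
  cliff1 : forall x, cliff x (basis_form R finset.set0) = 1%:M;
  cliffM : forall x a b,
    cliff x (cmul (g x) a b) = cliff x a *m cliff x b;
  cliff_irr : forall x (U : {vspace 'cV[R]_8}),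
    (forall a e, e \in U -> cliff x a *m e \in U) ->
    U = 0%VS \/ U = fullv;
  vol_signP : vol_sign = 1 \/ vol_sign = -1;
  cliff_vol : forall x, cliff x (vol_form (g x)) = vol_sign%:M;
  pairing_smooth : smooth_mx pairing;
  pairing_sym : forall x, (pairing x)^T = pairing x;
  pairing_nondeg : forall x, pairing x \in unitmx;
  pairing_adm : forall x a,
    (cliff x a)^T *m pairing x = pairing x *m cliff x (pi_tau a)
}.

Definition spair (R : realType) (g : 'rV[R]_7 -> 'M[R]_7)
    (S : spinor_bundle g) (x : 'rV[R]_7) (e1 e2 : 'cV[R]_8) : R :=
  (e1^T *m pairing S x *m e2) 0 0.

Definition isotropic (R : realType) (g : 'rV[R]_7 -> 'M[R]_7)
    (S : spinor_bundle g) (eps : 'rV[R]_7 -> 'cV[R]_8) : Prop :=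
  forall x, spair S x (eps x) (eps x) = 0.

Definition psi_lower (R : realType) (g : 'rV[R]_7 -> 'M[R]_7)
    (S : spinor_bundle g) (x : 'rV[R]_7) (a : polyform R 7) : 'M[R]_8 :=
  cliff S x
    (2^-1 *: (a + vol_sign S *: cmul (g x) (vol_form (g x)) a)).

(* The matrix eps *m (pairing *m eps)^T is the endomorphism
   w |-> spair w eps *: eps. *)
Definition is_square (R : realType) (g : 'rV[R]_7 -> 'M[R]_7)
    (S : spinor_bundle g) (mu : R) (eps : 'rV[R]_7 -> 'cV[R]_8)
    (a : 'rV[R]_7 -> polyform R 7) : Prop :=
  forall x, lower_form (a x) /\
    psi_lower S x (a x) = mu *: (eps x *m (pairing S x *m eps x)^T).

Definition associated_triple (R : realType) (g : 'rV[R]_7 -> 'M[R]_7)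
    (S : spinor_bundle g) (eps : 'rV[R]_7 -> 'cV[R]_8)
    (t1 t2 t3 : 'rV[R]_7 -> 'rV[R]_7) : Prop :=
  exists mu : R, (mu = 1 \/ mu = -1) /\
    is_square S mu eps
      (fun x => wedge (one_form (t1 x))
                  (wedge (one_form (t2 x)) (one_form (t3 x)))).

Definition eta43 (R : realType) : 'M[R]_7 :=
  diag_mx (\row_(a < 7) if (a < 4)%N then 1 else -1).

(* The rows of [invmx e^T] are the coframe dual to the frame given by the
   rows of [e]. *)
Definition coframe (R : realType) (e : 'M[R]_7) (a : 'I_7) : 'rV[R]_7 :=
  row a (invmx e^T).

(* A spin frame: a pseudo-orthonormal frame [e] of the tangent bundle together
   with a frame of the spinor bundle (the columns of [u]) in which the Clifford
   action of the dual coframe and the pairing are constant. *)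
Definition spin_frame (R : realType) (g : 'rV[R]_7 -> 'M[R]_7)
    (S : spinor_bundle g) (e : 'rV[R]_7 -> 'M[R]_7)
    (u : 'rV[R]_7 -> 'M[R]_8) : Prop :=
  [/\ smooth_mx e /\ (forall x, e x *m g x *m (e x)^T = eta43 R),
      smooth_mx u /\ (forall x, u x \in unitmx),
      exists gam : 'I_7 -> 'M[R]_8, forall x a,
        cliff S x (one_form (coframe (e x) a)) *m u x = u x *m gam a
    & exists B0 : 'M[R]_8, forall x, (u x)^T *m pairing S x *m u x = B0].

(* omega_ab(v) = (nabla_v (e_b)^flat)(e_a) = g(e_a, nabla_v e_b) *)
Definition conn_form (R : realType) (g : 'rV[R]_7 -> 'M[R]_7)
    (A : 'rV[R]_7 -> 'I_7 -> 'M[R]_7) (e : 'rV[R]_7 -> 'M[R]_7)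
    (a b : 'I_7) (v x : 'rV[R]_7) : R :=
  vdot (nabla g A v (fun y => flat (g y) (row b (e y))) x) (row a (e x)).

(* The lift of nabla to the spinor bundle: in a spin frame it is
   d + 1/4 \sum_ab omega_ab gamma^a gamma^b.  It does not depend on the choice
   of the spin frame. *)
Definition spin_nabla (R : realType) (g : 'rV[R]_7 -> 'M[R]_7)
    (A : 'rV[R]_7 -> 'I_7 -> 'M[R]_7) (S : spinor_bundle g)
    (e : 'rV[R]_7 -> 'M[R]_7) (u : 'rV[R]_7 -> 'M[R]_8)
    (v : 'rV[R]_7) (eps : 'rV[R]_7 -> 'cV[R]_8) (x : 'rV[R]_7) : 'cV[R]_8 :=
  u x *m derive_mx v (fun y => invmx (u y) *m eps y) x +
  4^-1 *: \sum_a \sum_b conn_form g A e a b v x *: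
    (cliff S x (one_form (coframe (e x) a)) *m
     cliff S x (one_form (coframe (e x) b)) *m eps x).

Definition parallel_spinor (R : realType) (g : 'rV[R]_7 -> 'M[R]_7)
    (A : 'rV[R]_7 -> 'I_7 -> 'M[R]_7) (S : spinor_bundle g)
    (eps : 'rV[R]_7 -> 'cV[R]_8) : Prop :=
  exists e u, spin_frame S e u /\
    forall v x, spin_nabla A S e u v eps x = 0.

(* Coordinate order on R^7: (x_1, y_1, x_2, y_2, x_3, y_3, z), with the pairs
   (x_i, y_i) indexed from 0. *)

Definition ix (i : 'I_3) : 'I_7 := inord (2 * i).
Definition iy (i : 'I_3) : 'I_7 := inord (2 * i).+1.
Definition iz : 'I_7 := inord 6.

Definition metric43 (R : realType) (H K : 'I_3 -> 'rV[R]_7 -> R)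
    (F : 'rV[R]_7 -> R) (x : 'rV[R]_7) : 'M[R]_7 :=
  \sum_(i < 3)
    (H i x *: delta_mx (ix i) (ix i) +
     expR (K i x) *: (delta_mx (ix i) (iy i) + delta_mx (iy i) (ix i))) +
  expR (F x) *: delta_mx iz iz.

(* Main.v *)
(* The forms t_j = e^{K_j} dx_j are the metric duals of the d_{y_j}, span a
   null 3-plane, and their Clifford product is +-eps (x) B(-, eps); hence they
   annihilate eps, and the Clifford relations show that this product, and so
   eps, is non-zero.  Differentiating t_j . eps = 0 along the parallel spinor
   gives (nabla_v t_j) . eps = 0.  A covector s annihilating eps satisfies
   g(s, t_k) = 0 and g(s, s) = 0, hence s(d_{y_k}) = 0 and s(d_z) = 0.  For
   v = d_{y_i} and s = nabla_v t_j the Levi-Civita part of these components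
   only involves derivatives of vanishing metric coefficients, so that they
   reduce to A(d_{y_i}, d_{y_j}, d_{y_k}) and A(d_{y_i}, d_{y_j}, d_z). *)

From HB Require Import structures.
From Pilot Require Import Defs.
From mathcomp Require Import all_boot all_order all_algebra all_fingroup.
From mathcomp Require Import all_classical all_reals all_analysis.
From mathcomp Require Import lra.
(* Otherwise [derive_mx] would be the lemma of the analysis library. *)
Import Pilot.Defs.

Set Implicit Arguments.
Unset Strict Implicit.
Unset Printing Implicit Defensive.

Import Order.TTheory GRing.Theory Num.Theory.
Import numFieldNormedType.Exports.

Local Open Scope ring_scope.

(** * Directional derivatives of matrix-valued functions *)

(** A relation rather than a value: it carries derivability along with the derivative, so that the
    product rule composes without side conditions. *)
Definition mx_derivative (R : realType) (n p q : nat) (v x : 'rV[R]_n.+1)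
    (M : 'rV[R]_n.+1 -> 'M[R]_(p, q)) (dM : 'M[R]_(p, q)) : Prop :=
  forall i j, is_derive x v (fun y => M y i j) (dM i j).

Section MatrixDerivative.
Variables (R : realType) (n : nat) (v x : 'rV[R]_n.+1).

Lemma smooth_derivable (f : 'rV[R]_n.+1 -> R) (i : 'I_n.+1) :
  smooth f -> derivable f x (evec R i).
Proof. by move=> /(_ 1%N) /= [_ /(_ i)] []. Qed.

(** [smooth] directly provides only the partial derivatives, hence the restriction to coordinate
    directions, here and below. *)
Lemma smooth_mx_derivative p q (M : 'rV[R]_n.+1 -> 'M[R]_(p, q)) i :
  smooth_mx M -> mx_derivative (evec R i) x M (derive_mx (evec R i) M x).
Proof.
move=> sM a b; rewrite mxE; apply/derivableP; exact: smooth_derivable.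
Qed.

Lemma mx_derivativeE p q (M : 'rV[R]_n.+1 -> 'M[R]_(p, q)) dM :
  mx_derivative v x M dM -> derive_mx v M x = dM.
Proof. by move=> h; apply/matrixP => i j; rewrite mxE; have [] := h i j. Qed.

Lemma mx_derivative_cst p q (M : 'M[R]_(p, q)) :
  mx_derivative v x (fun=> M) 0.
Proof. by move=> i j; rewrite mxE; apply: is_derive_cst. Qed.

Lemma mx_derivative_tr p q (M : 'rV[R]_n.+1 -> 'M[R]_(p, q)) dM :
  mx_derivative v x M dM -> mx_derivative v x (fun y => (M y)^T) dM^T.
Proof.
move=> h i j; rewrite mxE.
by under eq_fun do rewrite mxE; apply: h.
Qed.

Lemma mx_derivativeM p q r (M : 'rV[R]_n.+1 -> 'M[R]_(p, q))
    (N : 'rV[R]_n.+1 -> 'M[R]_(q, r)) dM dN :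
  mx_derivative v x M dM -> mx_derivative v x N dN ->
  mx_derivative v x (fun y => M y *m N y) (dM *m N x + M x *m dN).
Proof.
move=> hM hN i j.
have -> : (fun y => (M y *m N y) i j) =
    \sum_k (fun y => M y i k) * (fun y => N y k j).
  by apply/funext => y; rewrite mxE fct_sumE.
rewrite !mxE -big_split /=.
apply: is_derive_sum => k.
have -> : dM i k * N x k j + M x i k * dN k j =
    M x i k *: dN k j + N x k j *: dM i k.
  by rewrite addrC [dM _ _ * _]mulrC.
exact: is_deriveM.
Qed.

Lemma mx_derivative_row p q (M : 'rV[R]_n.+1 -> 'M[R]_(p, q)) dM i :
  mx_derivative v x M dM -> mx_derivative v x (fun y => row i (M y)) (row i dM).
Proof.
by move=> h a b; rewrite mxE; under eq_fun do rewrite mxE; apply: h.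
Qed.

Lemma derivable_prodr (I : Type) (r : seq I) (f : I -> 'rV[R]_n.+1 -> R) :
  (forall i, derivable (f i) x v) ->
  derivable (fun y => \prod_(i <- r) f i y) x v.
Proof.
move=> h; elim: r => [|a r IH].
  by under eq_fun do rewrite big_nil; apply: derivable_cst.
under eq_fun do rewrite big_cons.
by apply: derivableM.
Qed.

Lemma derivable_sumr (I : Type) (r : seq I) (f : I -> 'rV[R]_n.+1 -> R) :
  (forall i, derivable (f i) x v) ->
  derivable (fun y => \sum_(i <- r) f i y) x v.
Proof.
move=> h; elim: r => [|a r IH].
  by under eq_fun do rewrite big_nil; apply: derivable_cst.
under eq_fun do rewrite big_cons.
by apply: derivableD.
Qed.

Lemma derivable_det p (M : 'rV[R]_n.+1 -> 'M[R]_p) :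
  (forall i j, derivable (fun y => M y i j) x v) ->
  derivable (fun y => \det (M y)) x v.
Proof.
move=> h; apply: derivable_sumr => s.
apply: derivableM; first exact: derivable_cst.
exact: derivable_prodr.
Qed.

(** By Cramer's rule. Invertibility is asked at every point because [invmx] is given by the adjugate
    only there. *)
Lemma derivable_invmx p (M : 'rV[R]_n.+1 -> 'M[R]_p) :
  (forall y, M y \in unitmx) ->
  (forall i j, derivable (fun y => M y i j) x v) ->
  forall i j, derivable (fun y => invmx (M y) i j) x v.
Proof.
move=> uM h i j.
have -> : (fun y => invmx (M y) i j) =
   (fun y => (\det (M y))^-1) *
   (fun y => cofactor (M y) j i).
  by apply/funext => y; rewrite /invmx uM !mxE.
apply: derivableM.
  apply: derivableV; last exact: derivable_det.
  by have := uM x; rewrite unitmxE unitfE.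
apply: derivableM; first exact: derivable_cst.
apply: derivable_det => a b.
under eq_fun do rewrite !mxE; exact: h.
Qed.

Lemma mx_derivative_inv p (M : 'rV[R]_n.+1 -> 'M[R]_p) dM :
  (forall y, M y \in unitmx) -> mx_derivative v x M dM ->
  mx_derivative v x (fun y => invmx (M y)) (derive_mx v (fun y => invmx (M y)) x).
Proof.
move=> uM h i j; rewrite mxE; apply/derivableP.
apply: derivable_invmx => // a b; exact: ex_derive.
Qed.

End MatrixDerivative.

(** * Exterior algebra and Clifford product by a one-form *)

Section ExteriorAlgebra.
Variables (R : realType) (n : nat).
Implicit Types (s t v : 'rV[R]_n) (a b c : polyform R n).

Lemma one_formE t (I : {set 'I_n}) :
  one_form t I = \sum_i t 0 i * (I == finset.set1 i)%:R.
Proof. by rewrite sum_ffunE; apply: eq_bigr => i _; rewrite !ffunE. Qed.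

Lemma one_form_set1 t i : one_form t (finset.set1 i) = t 0 i.
Proof.
rewrite one_formE (bigD1 i) //= eqxx mulr1 big1 ?addr0 // => j ji.
by rewrite (inj_eq finset.set1_inj) eq_sym (negbTE ji) mulr0.
Qed.

Lemma one_form_card t (I : {set 'I_n}) : #|I| != 1%N -> one_form t I = 0.
Proof.
move=> I1; rewrite one_formE big1 // => i _.
by case: eqP => [e|]; [rewrite e cards1 in I1 | rewrite mulr0].
Qed.

Fact one_form_is_linear : linear (@one_form R n).
Proof.
move=> k s t; rewrite /one_form scaler_sumr -big_split /=.
by apply: eq_bigr => i _; rewrite !mxE scalerDl scalerA.
Qed.
HB.instance Definition _ :=
  GRing.isLinear.Build R 'rV[R]_n (polyform R n) _ _ one_form_is_linear.


Lemma wedgeDl a b c : wedge (a + b) c = wedge a c + wedge b c.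
Proof.
apply/ffunP => K; rewrite !ffunE -big_split /=.
by apply: eq_bigr => I _; rewrite !ffunE mulrDr mulrDl.
Qed.

Lemma wedgeZl k a b : wedge (k *: a) b = k *: wedge a b.
Proof.
apply/ffunP => K; rewrite !ffunE scaler_sumr /=.
by apply: eq_bigr => I _; rewrite !ffunE /GRing.scale /= mulrCA !mulrA.
Qed.

Lemma contractDl v w a : contract (v + w) a = contract v a + contract w a.
Proof.
apply/ffunP => K; rewrite !ffunE -big_split /=.
by apply: eq_bigr => I _; rewrite !mxE !mulrDl.
Qed.

Lemma contractZl k v a : contract (k *: v) a = k *: contract v a.
Proof.
apply/ffunP => K; rewrite !ffunE scaler_sumr.
by apply: eq_bigr => I _; rewrite !mxE /GRing.scale /= !mulrA.
Qed.

Lemma shuffle_sign_set1 (i j : 'I_n) :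
  shuffle_sign R (finset.set1 i) (finset.set1 j) = (-1) ^+ (j < i)%N.
Proof.
rewrite /shuffle_sign; congr (_ ^+ _).
case: ltnP => ji.
  apply/eqP/cards1P; exists (i, j); apply/setP => -[p q].
  rewrite !inE /= xpair_eqE.
  by case: eqP => // ->; case: eqP => // ->; rewrite ji.
apply: eq_card0 => -[p q]; rewrite !inE /=.
by case: eqP => // ->; case: eqP => // -> /=; rewrite ltnNge ji.
Qed.

Lemma wedge_one_form_anti s t :
  wedge (one_form s) (one_form t) + wedge (one_form t) (one_form s) = 0.
Proof.
apply/ffunP => K; rewrite !ffunE.
have inv (I : {set 'I_n}) : I \subset K -> K :\: (K :\: I) = I.
  by move=> IK; rewrite finset.setDDr finset.setDv finset.set0U (finset.setIidPr IK).
(* Taking complements in [K] matches each term of one product with a term of the other; only pairs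
   of distinct singletons contribute, and their shuffle signs are opposite. *)
rewrite [X in _ + X](reindex_onto (fun I => K :\: I) (fun I => K :\: I)) /=;
  last by move=> I; apply: inv.
rewrite [X in _ + X](eq_bigl (fun I : {set 'I_n} => I \subset K)); last first.
  move=> I; rewrite finset.subsetDl /=.
  apply/eqP/idP => [<-|]; [exact: finset.subsetDl | exact: inv].
rewrite -big_split /= big1 // => I IK; rewrite inv //.
have [|I1] := boolP (#|I| == 1%N); last first.
  by rewrite (one_form_card s I1) !(mulr0, mul0r) addr0.
have [|J1] := boolP (#|K :\: I| == 1%N); last first.
  by rewrite (one_form_card t J1) !(mulr0, mul0r) addr0.
move=> /cards1P[j eJ] /cards1P[i eI]; rewrite eJ eI !shuffle_sign_set1.
have ij : i != j.
  apply/eqP => ij; have : j \in K :\: I by rewrite eJ inE.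
  by rewrite eI ij !inE eqxx.
rewrite [X in _ + X]mulrAC -mulrDl.
rewrite -mulrDl.
have [_|_|/val_inj] := ltngtP i j; rewrite ?expr0 ?expr1 ?subrr ?addNr ?mul0r //.
by move=> e; rewrite e eqxx in ij.
Qed.

Lemma contract_one_form v t :
  contract v (one_form t) = vdot t v *: basis_form R finset.set0.
Proof.
apply/ffunP => J; rewrite !ffunE.
have [->|J0] := eqVneq J finset.set0.
  rewrite /vdot mxE /GRing.scale /= mulr1.
  apply: eq_big => [i|i _]; first by rewrite inE.
  rewrite finset.setU0 one_form_set1 mxE.
  rewrite /shuffle_sign (_ : finset.finset _ = finset.set0).
    by rewrite cards0 expr0 mulr1 mulrC.
  by apply/setP => p; rewrite !inE andbF.
rewrite [RHS]mulr0 big1 // => i iJ.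
by rewrite one_form_card ?mulr0 // cardsU1 iJ /= add1n eqSS cards_eq0.
Qed.

(** A form without the factor dx_i. This condition is stable under [wedge] and makes the contraction
    with d_i vanish. *)
Definition vanishes_on (i : 'I_n) a : Prop :=
  forall I : {set 'I_n}, i \in I -> a I = 0.

Lemma vanishes_on_one_form i t : t 0 i = 0 -> vanishes_on i (one_form t).
Proof.
move=> ti I iI; rewrite one_formE big1 // => j _.
case: eqP => [eI|]; last by rewrite mulr0.
by move: iI; rewrite eI inE => /eqP <-; rewrite ti mul0r.
Qed.

Lemma vanishes_on_wedge i a b :
  vanishes_on i a -> vanishes_on i b -> vanishes_on i (wedge a b).
Proof.
move=> ha hb K iK; rewrite ffunE big1 // => I IK.
have [iI|iI] := boolP (i \in I); first by rewrite ha // mulr0 mul0r.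
by rewrite hb ?mulr0 // !inE iI.
Qed.

Lemma contract_vanishes_on i a :
  vanishes_on i a -> contract (evec R i) a = 0.
Proof.
move=> ha; apply/ffunP => J; rewrite !ffunE big1 // => j jJ.
rewrite mxE eqxx /=; case: eqP => [->|]; last by rewrite !mul0r.
by rewrite ha ?mulr0 // !inE eqxx.
Qed.

Variable G : 'M[R]_n.

Lemma flatK : G \in unitmx -> cancel (flat G) (sharp G).
Proof. by move=> uG v; rewrite /sharp /flat mulmxK. Qed.

Lemma sharpK : G \in unitmx -> cancel (sharp G) (flat G).
Proof. by move=> uG v; rewrite /sharp /flat mulmxKV. Qed.

Lemma cmul1D s t a : cmul1 G (s + t) a = cmul1 G s a + cmul1 G t a.
Proof. by rewrite /cmul1 raddfD /= wedgeDl /sharp mulmxDl contractDl addrACA. Qed.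

Lemma cmul1Z k t a : cmul1 G (k *: t) a = k *: cmul1 G t a.
Proof. by rewrite /cmul1 linearZ /= wedgeZl /sharp -scalemxAl contractZl scalerDr. Qed.

(** Only singletons [I] carry a coefficient of a one-form, and for them the antisymmetrization runs
    over the trivial group. *)
Lemma cmul_one_form t a : cmul G (one_form t) a = cmul1 G t a.
Proof.
(* The cardinality is generalized to [p], since the type ['S_#|I|] blocks rewriting [#|I|] to 1 in
   place. *)
have word1 p (f : 'I_p -> 'I_n) i : p = 1%N -> (forall k, f k = i) ->
    \sum_(s : 'S_p) ((-1) ^+ s : R) *:
      foldr (fun k c => cmul1 G (evec R (f (s k))) c) a (enum 'I_p) =
    cmul1 G (evec R i) a.
  move=> p1; subst p => fi.
  rewrite (bigD1 (1%g : 'S_1)) //= big1 => [|s]; last first.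
    by rewrite (permS1 s) eqxx.
  by rewrite addr0 odd_perm1 expr0 scale1r enum_ordSl enum_ord0 /= fi.
rewrite /cmul [in RHS](row_sum_delta t).
transitivity (\sum_(I : {set 'I_n}) \sum_i
   (t 0 i * (I == finset.set1 i)%:R) *: cmul1 G (evec R i) a).
  apply: eq_bigr => I _; rewrite one_formE mulr_suml scaler_suml.
  apply: eq_bigr => i _; have [->|_] := eqVneq I (finset.set1 i); last first.
    by rewrite mulr0 mul0r !scale0r.
  rewrite (word1 _ _ i) ?cards1 ?fact0 ?divr1 //.
  by move=> k; apply/eqP; rewrite -finset.in_set1; apply: enum_valP.
rewrite exchange_big /=.
rewrite (big_morph (fun v => cmul1 G v a) (id1 := 0) (op1 := +%R)) //; last 2 first.
- by move=> *; exact: cmul1D.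
- by rewrite -(scale0r 0) cmul1Z scale0r.
apply: eq_bigr => i _; rewrite (bigD1 (finset.set1 i)) //= eqxx mulr1.
rewrite big1 ?addr0 ?cmul1Z //.
by move=> I /negbTE ->; rewrite mulr0 scale0r.
Qed.

End ExteriorAlgebra.

(** * The Clifford module and the square of a spinor *)

Lemma outer_eq0 (R : fieldType) m p (c : 'cV[R]_m) (r : 'rV[R]_p) :
  r != 0 -> c *m r = 0 -> c = 0.
Proof.
move=> r0 cr0; have [j rj] : exists j, r 0 j != 0.
  apply/existsP; apply: contraNT r0; rewrite negb_exists => /forallP h.
  by apply/eqP/rowP => j; rewrite mxE; apply/eqP; rewrite -[_ == _]negbK h.
apply/colP => i; rewrite mxE.
have /eqP := congr1 (fun M : 'M[R]_(m, p) => M i j) cr0.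
rewrite !mxE big_ord1 mulf_eq0 (negbTE rj) orbF => /eqP.
by [].
Qed.

Section CliffordModule.
Variables (R : realType) (g : 'rV[R]_7 -> 'M[R]_7) (S : spinor_bundle g).
Variable x : 'rV[R]_7.

HB.instance Definition _ :=
  GRing.isLinear.Build R (polyform R 7) 'M[R]_8 _ (cliff S x) (cliff_linear S x).

Definition gamma (t : 'rV[R]_7) : 'M[R]_8 := cliff S x (one_form t).

Fact gamma_is_linear : linear gamma.
Proof. by move=> k s t; rewrite /gamma !linearP. Qed.
HB.instance Definition _ :=
  GRing.isLinear.Build R 'rV[R]_7 'M[R]_8 _ gamma gamma_is_linear.

Lemma cliff_cmul1 t a : cliff S x (cmul1 (g x) t a) = gamma t *m cliff S x a.
Proof. by rewrite -cmul_one_form cliffM. Qed.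

(** The wedge parts cancel by antisymmetry; the contractions of one-forms are scalars. *)
Lemma gamma_anticomm s t :
  gamma s *m gamma t + gamma t *m gamma s =
  (vdot t (sharp (g x) s) + vdot s (sharp (g x) t))%:M.
Proof.
rewrite -!cliff_cmul1 -linearD /= /cmul1 addrACA wedge_one_form_anti add0r.
rewrite !contract_one_form -scalerDl linearZ /= cliff1.
by rewrite scale_scalar_mx mulr1.
Qed.

Lemma cliff_wedge i s a : sharp (g x) s = evec R i -> vanishes_on i a ->
  cliff S x (wedge (one_form s) a) = gamma s *m cliff S x a.
Proof.
by move=> si ai; rewrite -cliff_cmul1 /cmul1 si contract_vanishes_on // addr0.
Qed.

(** The volume form acts as l with l^2 = 1, so the two halves of [psi_lower] act identically. *)
Lemma psi_lowerE a : psi_lower S x a = cliff S x a.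
Proof.
rewrite /psi_lower linearZ /= linearD /= linearZ /= cliffM cliff_vol.
rewrite mul_scalar_mx scalerA.
have -> : vol_sign S * vol_sign S = 1.
  by case: (vol_signP S) => ->; rewrite ?mulr1 // mulN1r opprK.
by rewrite scale1r -[X in X + X]scale1r -scalerDl scalerA mulVf ?scale1r // pnatr_eq0.
Qed.

Hypothesis g_sym : (g x)^T = g x.
Hypothesis g_unit : g x \in unitmx.

Lemma gamma_flat_anticomm t w :
  gamma t *m gamma (flat (g x) w) + gamma (flat (g x) w) *m gamma t =
  (vdot t w *+ 2)%:M.
Proof.
rewrite addrC gamma_anticomm (flatK g_unit) mulr2n; congr (_ + _)%:M.
rewrite /vdot /flat /sharp trmx_mul trmx_inv g_sym mulmxA mulmxK //.
by rewrite -[w in LHS]trmxK -trmx_mul mxE.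
Qed.

Lemma gamma_sqr t : gamma t *m gamma t = (vdot t (sharp (g x) t))%:M.
Proof.
have := gamma_flat_anticomm t (sharp (g x) t).
rewrite (sharpK g_unit) => h.
apply: (scalerI (_ : 2%:R != 0 :> R)); first by rewrite pnatr_eq0.
by rewrite !scaler_nat mulr2n h raddfMn.
Qed.

(** * Clifford action of a null triple of one-forms *)

Section IsotropicTriple.
Variables (y : 'I_3 -> 'I_7) (y_inj : injective y).
Hypothesis y_null : forall i j, g x (y i) (y j) = 0.

Let t i := flat (g x) (evec R (y i)).

Let vdot_evec (s : 'rV[R]_7) i : vdot s (evec R i) = s 0 i.
Proof.
rewrite /vdot mxE (bigD1 i) //= !mxE !eqxx mulr1 big1 ?addr0 // => j ji.
by rewrite !mxE (negbTE ji) andbF mulr0.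
Qed.

Let tE i j : t i 0 j = g x (y i) j.
Proof. by rewrite /t /flat /evec -rowE mxE. Qed.

Let gamma_triple_anticomm i j :
  gamma (t i) *m gamma (t j) = - (gamma (t j) *m gamma (t i)).
Proof.
apply/eqP; rewrite -addr_eq0 gamma_flat_anticomm vdot_evec tE y_null.
by rewrite mul0rn raddf0.
Qed.

Let gamma_triple_sqr i : gamma (t i) *m gamma (t i) = 0.
Proof. by rewrite gamma_sqr (flatK g_unit) vdot_evec tE y_null raddf0. Qed.

Variables i1 i2 i3 : 'I_3.
Hypotheses (n12 : i1 != i2) (n13 : i1 != i3) (n23 : i2 != i3).

(** The sharp of [t i] is the basis vector of index [y i], on which all the [t j] vanish by
    [y_null]; every contraction term of the Clifford product drops out. *)
Lemma cliff_triple :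
  cliff S x (wedge (one_form (t i1)) (wedge (one_form (t i2)) (one_form (t i3)))) =
  gamma (t i1) *m (gamma (t i2) *m gamma (t i3)).
Proof.
have v i j : vanishes_on (y i) (one_form (t j)).
  by apply: vanishes_on_one_form; rewrite tE.
rewrite (@cliff_wedge (y i1)) ?(flatK g_unit) ?(@cliff_wedge (y i2)) ?(flatK g_unit) //.
exact: vanishes_on_wedge.
Qed.

(** The coordinate covectors [s i] are dual to the [t j]: their Clifford anticommutators are 2 if i
    = j and 0 otherwise. They remove the factors of a vanishing product one at a time, until 2 =
    0. *)
Lemma gamma_triple_neq0 : gamma (t i1) *m (gamma (t i2) *m gamma (t i3)) != 0.
Proof.
pose s i := evec R (y i).
have st i j : gamma (s i) *m gamma (t j) =
    ((i == j)%:R *+ 2)%:M - gamma (t j) *m gamma (s i).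
  apply/eqP; rewrite eq_sym subr_eq gamma_flat_anticomm vdot_evec.
  by rewrite mxE eqxx /= (inj_eq y_inj) [j == i]eq_sym.
have two_neq0 : 2%:R != 0 :> R by rewrite pnatr_eq0.
(* From s t + t s = 2: if both t M and t s M vanish, then so does 2 M. *)
have strip i (M : 'M[R]_8) :
    gamma (t i) *m M = 0 -> gamma (t i) *m (gamma (s i) *m M) = 0 -> M = 0.
  move=> tM tsM; have := congr1 (mulmx (gamma (s i))) tM.
  rewrite mulmxA st eqxx mulmxBl -mulmxA tsM subr0 mulmx0 mul_scalar_mx.
  by move/eqP; rewrite scaler_eq0 (negbTE two_neq0) => /eqP.
have santi i j : i != j -> gamma (s i) *m gamma (t j) = - (gamma (t j) *m gamma (s i)).
  by move=> /negbTE ij; rewrite st ij mul0rn raddf0 sub0r.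
apply/eqP => h1.
have h2 : gamma (t i2) *m gamma (t i3) = 0.
  apply: (strip i1) => //.
  (* Moving [s i1] to the right past [t i2] and [t i3] costs two signs and restores the vanishing
     triple product on the left. *)
  rewrite !mulmxA -(mulmxA (gamma (t i1))) santi // mulmxN mulNmx.
  rewrite -!mulmxA santi // !mulmxN opprK mulmxA !mulmxA.
  by rewrite -(mulmxA (gamma (t i1))) h1 mul0mx.
have h3 : gamma (t i3) = 0.
  apply: (strip i2) => //.
  by rewrite santi // mulmxN mulmxA h2 mul0mx oppr0.
have := st i3 i3; rewrite h3 eqxx mulmx0 mul0mx subr0 => /matrixP/(_ 0 0).
by rewrite !mxE => /esym/eqP; rewrite (negbTE two_neq0).
Qed.

(** The extra factor anticommutes up to its own copy, and [gamma (t i)] squares to zero. *)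
Lemma gamma_triple_annihilates i : i \in [:: i1; i2; i3] ->
  gamma (t i) *m (gamma (t i1) *m (gamma (t i2) *m gamma (t i3))) = 0.
Proof.
rewrite !inE => /or3P[] /eqP ->; rewrite !mulmxA.
- by rewrite gamma_triple_sqr !mul0mx.
- rewrite (gamma_triple_anticomm i2 i1) !mulNmx -(mulmxA (gamma _)).
  by rewrite gamma_triple_sqr mulmx0 mul0mx oppr0.
- rewrite (gamma_triple_anticomm i3 i1) !mulNmx -(mulmxA (gamma (t i1))).
  rewrite (gamma_triple_anticomm i3 i2) mulmxN mulNmx opprK -!mulmxA.
  by rewrite gamma_triple_sqr !mulmx0.
Qed.

(** * Covectors annihilating a spinor whose square is the triple *)

Section Spinor.
Variables (mu : R) (psi : 'cV[R]_8).
Hypothesis psi_square :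
  psi_lower S x
    (wedge (one_form (t i1)) (wedge (one_form (t i2)) (one_form (t i3)))) =
  mu *: (psi *m (pairing S x *m psi)^T).

Lemma square_triple_neq0 : mu != 0 /\ psi != 0.
Proof.
have := gamma_triple_neq0; rewrite -cliff_triple -psi_lowerE psi_square.
rewrite scaler_eq0 negb_or => /andP[-> psi2]; split=> //.
by apply: contraNneq psi2 => ->; rewrite mul0mx.
Qed.

(** Multiplying the square by [gamma (t i)] gives the column [gamma (t i) *m psi] times the row of
    B(-, psi), which is non-zero because the pairing is non-degenerate. *)
Lemma square_triple_annihilated i : i \in [:: i1; i2; i3] ->
  gamma (t i) *m psi = 0.
Proof.
have [mu0 psi0] := square_triple_neq0.
move=> /gamma_triple_annihilates; rewrite -cliff_triple -psi_lowerE psi_square.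
rewrite -scalemxAr => /eqP; rewrite scaler_eq0 (negbTE mu0) mulmxA => /eqP.
apply: outer_eq0; apply: contraNneq psi0 => /(congr1 trmx).
rewrite trmxK trmx0 => h.
by rewrite -[psi](mulKmx (pairing_nondeg S x)) h mulmx0.
Qed.

(** Both [gamma s] and [gamma (t i)] kill [psi], hence so does their anticommutator, the scalar 2
    s(d_{y i}). *)
Lemma annihilator_triple s i : i \in [:: i1; i2; i3] ->
  gamma s *m psi = 0 -> s 0 (y i) = 0.
Proof.
have [_ psi0] := square_triple_neq0.
move=> /square_triple_annihilated ti s0.
have := congr1 (mulmx^~ psi) (gamma_flat_anticomm s (evec R (y i))).
rewrite /= mulmxDl -!mulmxA ti s0 !mulmx0 addr0 mul_scalar_mx => /esym/eqP.
by rewrite scaler_eq0 (negbTE psi0) orbF vdot_evec mulrn_eq0 => /eqP.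
Qed.

Lemma annihilator_null s : gamma s *m psi = 0 -> vdot s (sharp (g x) s) = 0.
Proof.
have [_ psi0] := square_triple_neq0.
move=> s0; have := congr1 (mulmx^~ psi) (gamma_sqr s).
rewrite /= -mulmxA s0 mulmx0 mul_scalar_mx => /esym/eqP.
by rewrite scaler_eq0 (negbTE psi0) orbF => /eqP.
Qed.

End Spinor.
End IsotropicTriple.
End CliffordModule.

(** * Metric connections in coordinates *)

Section Connection.
Variables (R : realType) (n : nat) (g : 'rV[R]_n.+1 -> 'M[R]_n.+1).
Variables (A : 'rV[R]_n.+1 -> 'I_n.+1 -> 'M[R]_n.+1).
Variables (x : 'rV[R]_n.+1) (m : 'I_n.+1).
Hypothesis g_sym : forall y, (g y)^T = g y.
Hypothesis g_unit : g x \in unitmx.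

(* By Koszul's formula [koszul i j] is g(nabla_m d_i, d_j). *)
Definition koszul : 'M[R]_n.+1 := \matrix_(i, j)
  (A x m i j + 2^-1 * (partial m (fun y => g y i j) x
     + partial i (fun y => g y m j) x - partial j (fun y => g y m i) x)).

Let g_symE i j : (fun y => g y i j) = (fun y => g y j i).
Proof. by apply/funext => y; rewrite -[in LHS]g_sym mxE. Qed.

(** Metric compatibility of the connection: the contorsion cancels by antisymmetry. *)
Lemma koszul_tr dg : mx_derivative (evec R m) x g dg -> (A x m)^T = - A x m ->
  koszul + koszul^T = dg.
Proof.
move=> hg hA; apply/matrixP => i j; rewrite !mxE.
have -> : A x m j i = - A x m i j by move/matrixP: hA => /(_ i j); rewrite !mxE.
rewrite (g_symE j i) /partial; have [_ ->] := hg i j; lra.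
Qed.

(** The Leibniz rule for w = w^i d_i, the metric dual being compatible with the connection. *)
Lemma nabla_flat (w : 'rV[R]_n.+1 -> 'rV[R]_n.+1) dw dg :
  mx_derivative (evec R m) x w dw -> mx_derivative (evec R m) x g dg ->
  nabla g A (evec R m) (fun y => flat (g y) (w y)) x =
  dw *m g x + w x *m koszul.
Proof.
move=> hw hg.
rewrite /nabla /nabla_LC.
rewrite (mx_derivativeE (M := fun y => flat (g y) (w y)) (mx_derivativeM hw hg)).
pose C := \matrix_(k, j) christoffel g x k m j.
(* Without [A] this is g(nabla_m d_i, d_j) = d_m g_ij - g(d_i, nabla_m d_j); lowering the index of
   the Christoffel symbols cancels the inverse metric. *)
have -> : koszul = dg - g x *m C + A x m.
  apply/matrixP => i j; rewrite !mxE.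
  under eq_bigr do rewrite !mxE /christoffel mulrCA mulr_sumr.
  rewrite -mulr_sumr exchange_big /=.
  under eq_bigr do (under eq_bigr do rewrite mulrA).
  under eq_bigr do rewrite -mulr_suml.
  under eq_bigr => l _.
    have := congr1 (fun M : 'M[R]_n.+1 => M i l) (mulmxV g_unit).
    rewrite /= !mxE => ->; over.
  rewrite (bigD1 i) //= big1 => [|l li]; last by rewrite eq_sym (negbTE li) mul0r.
  rewrite eqxx mul1r addr0.
  rewrite (g_symE j i) /partial; have [_ ->] := hg i j.
  lra.
rewrite mulmxDr mulmxBr -!addrA; congr (_ + _); rewrite !addrA; congr (_ + _ + _).
  congr (- _); rewrite mulmxA -/(flat (g x) (w x)); apply/rowP => j.
  rewrite !mxE (bigD1 m) //= [X in _ + X]big1 => [|i im]; last first.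
    by rewrite big1 // => k _; rewrite !mxE (negbTE im) andbF !mul0r.
  rewrite addr0; apply: eq_bigr => k _.
  by rewrite [evec R m _ _]mxE [C _ _]mxE !eqxx mul1r mulrC.
rewrite (flatK g_unit); apply/rowP => j.
rewrite mxE /tensor3 (bigD1 m) //= big1 => [|i im]; last first.
  by rewrite mxE (negbTE im) andbF mul0r.
rewrite addr0 [evec R m _ _]mxE !eqxx mul1r mxE (bigD1 j) //= big1 => [|i ij]; last first.
  by rewrite !mxE (negbTE ij) andbF mulr0.
by rewrite !mxE !eqxx mulr1 addr0.
Qed.

End Connection.

(** * Annihilators of a parallel spinor *)

(** The commutator of T with G_a G_b is 2 c_a G_b - 2 c_b G_a, and antisymmetry of w makes both
    terms contribute equally. The resulting 4 cancels the 1/4 of the spin connection. *)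
Lemma antisym_clifford_commutator (R : comNzRingType) n p (G : 'I_n -> 'M[R]_p)
    (T : 'M[R]_p) (c : 'I_n -> R) (w : 'I_n -> 'I_n -> R) (e : 'cV[R]_p) :
  (forall a, T *m G a + G a *m T = (c a *+ 2)%:M) ->
  (forall a b, w a b = - w b a) -> T *m e = 0 ->
  T *m (\sum_a \sum_b w a b *: (G a *m G b *m e)) =
  (\sum_b (\sum_a c a * w a b) *: (G b *m e)) *+ 4.
Proof.
move=> hT hw Te.
have TG a (f : 'cV[R]_p) : T *m (G a *m f) = (c a *+ 2) *: f - G a *m (T *m f).
  by rewrite -mul_scalar_mx -hT mulmxDl -!mulmxA addrK.
have TGG a b : T *m (G a *m G b *m e) =
    (c a *+ 2) *: (G b *m e) - (c b *+ 2) *: (G a *m e).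
  by rewrite -mulmxA !TG Te mulmx0 subr0 -scalemxAr.
have -> : T *m (\sum_a \sum_b w a b *: (G a *m G b *m e)) =
    \sum_a \sum_b w a b *: ((c a *+ 2) *: (G b *m e)) -
    \sum_a \sum_b w a b *: ((c b *+ 2) *: (G a *m e)).
  rewrite mulmx_sumr -sumrB; apply: eq_bigr => a _.
  rewrite mulmx_sumr -sumrB; apply: eq_bigr => b _.
  by rewrite -scalemxAr TGG scalerBr.
rewrite [X in _ - X]exchange_big /= -sumrB -sumrMnl.
rewrite [RHS](eq_bigr (fun b => \sum_a (c a * w a b) *: (G b *m e) *+ 4)); last first.
  by move=> b _; rewrite scaler_suml sumrMnl.
rewrite [RHS]exchange_big /=; apply: eq_bigr => a _.
rewrite -sumrB; apply: eq_bigr => b _.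
rewrite (hw b a) scaleNr opprK -mulr2n scalerA !scalerMnl.
by rewrite mulrnAr -mulrnA mulrC.
Qed.

(** * The connection in a spin frame and the Leibniz rule for the Clifford action *)

Section ParallelSpinor.
Variables (R : realType) (g : 'rV[R]_7 -> 'M[R]_7) (S : spinor_bundle g).
Variables (A : 'rV[R]_7 -> 'I_7 -> 'M[R]_7) (hA : contorsion A).
Variables (e : 'rV[R]_7 -> 'M[R]_7) (u : 'rV[R]_7 -> 'M[R]_8).
Hypothesis eu : spin_frame S e u.
Hypothesis g_sym : forall y, (g y)^T = g y.

Lemma eta43_sqr : eta43 R *m eta43 R = 1%:M.
Proof.
rewrite /eta43 mulmx_diag -diag_const_mx; congr diag_mx.
apply/rowP => i; rewrite !mxE; case: ifP => _; by rewrite ?mulr1 // mulN1r opprK.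
Qed.

Lemma frame_unit y : e y \in unitmx.
Proof.
have [[_ /(_ y) h] _ _ _] := eu.
have : e y *m (g y *m (e y)^T *m eta43 R) = 1%:M by rewrite !mulmxA h eta43_sqr.
by move/mulmx1_unit => [].
Qed.

Lemma frame_metric y : g y = invmx (e y) *m eta43 R *m (invmx (e y))^T.
Proof.
have [[_ /(_ y) <-] _ _ _] := eu.
by rewrite trmx_inv !mulmxA mulVmx ?frame_unit // mul1mx mulmxK // unitmx_tr frame_unit.
Qed.

Lemma frame_metric_unit y : g y \in unitmx.
Proof.
rewrite frame_metric !unitmx_mul unitmx_tr unitmx_inv frame_unit andbT /=.
by have /mulmx1_unit[->] := eta43_sqr.
Qed.

Variables (x : 'rV[R]_7) (m : 'I_7).

(** By [frame_metric], [g] is a product of inverses of the smooth frame and a constant matrix. *)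
Lemma metric_derivative :
  mx_derivative (evec R m) x g (derive_mx (evec R m) g x).
Proof.
have [[se _] _ _ _] := eu.
have hV := mx_derivative_inv frame_unit (smooth_mx_derivative x m se).
have -> : g = fun y => invmx (e y) *m eta43 R *m (invmx (e y))^T.
  by apply/funext => y; exact: frame_metric.
have h := mx_derivativeM (mx_derivativeM hV (mx_derivative_cst (evec R m) x (eta43 R)))
  (mx_derivative_tr hV).
by rewrite (mx_derivativeE h).
Qed.

Local Notation De := (derive_mx (evec R m) e x).
Local Notation Dg := (derive_mx (evec R m) g x).
Local Notation Q := (koszul g A x m).

(** Entry (a, b) is g(nabla_m e_a, e_b); the indices are swapped with respect to [conn_form]. *)
Definition frame_connection : 'M[R]_7 :=
  De *m g x *m (e x)^T + e x *m Q *m (e x)^T.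

Lemma conn_formE a b : conn_form g A e a b (evec R m) x = frame_connection b a.
Proof.
have [[se _] _ _ _] := eu.
have he := smooth_mx_derivative x m se.
rewrite /conn_form (nabla_flat A g_sym (frame_metric_unit x)
  (mx_derivative_row b he) metric_derivative).
rewrite /vdot /frame_connection -!row_mul -mulmxDl -linearD /= [LHS]mxE [RHS]mxE.
apply: eq_bigr => j _.
by rewrite [row _ _ _ _]mxE [(row _ _)^T _ _]mxE [row _ _ _ _]mxE [_^T _ _]mxE.
Qed.

Lemma frame_derivative :
  De *m g x *m (e x)^T + e x *m Dg *m (e x)^T + e x *m g x *m De^T = 0.
Proof.
have [[se ee] _ _ _] := eu.
have he := smooth_mx_derivative x m se.
have h := mx_derivativeM (mx_derivativeM he metric_derivative) (mx_derivative_tr he).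
rewrite -mulmxDl -(mx_derivativeE h) (_ : (fun y => _) = fun=> eta43 R).
  exact: (mx_derivativeE (mx_derivative_cst _ _ _)).
by apply/funext => y; rewrite ee.
Qed.

(** By metric compatibility, the symmetrization is the derivative of the constant matrix e g e^T. *)
Lemma frame_connection_antisym a b : frame_connection a b = - frame_connection b a.
Proof.
have [_ A_anti] := hA.
apply/eqP; rewrite -addr_eq0; apply/eqP.
have : frame_connection + frame_connection^T = 0.
  rewrite /frame_connection !raddfD /= !trmx_mul !trmxK g_sym.
  rewrite addrACA -!mulmxA -mulmxDr -mulmxDl.
  rewrite (koszul_tr g_sym metric_derivative (A_anti x m)).
  by rewrite addrAC !mulmxA frame_derivative.
by move/matrixP => /(_ a b); rewrite !mxE.
Qed.

(** As [w] is constant, [w *m Q] is nabla_m of its metric dual, by [nabla_flat]. The equation [ann]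
    is differentiated in the spin frame, where the Clifford matrices are constant. *)
Lemma nabla_annihilates (eps : 'rV[R]_7 -> 'cV[R]_8) (w : 'rV[R]_7) :
  smooth_mx eps -> spin_nabla A S e u (evec R m) eps x = 0 ->
  (forall y, gamma S y (flat (g y) w) *m eps y = 0) ->
  gamma S x (w *m Q) *m eps x = 0.
Proof.
move=> seps; rewrite /spin_nabla => par ann.
have [[se _] [su uu] [gam hgam] _] := eu.
have he := smooth_mx_derivative x m se.
have coframeE (t : 'rV[R]_7) y :
    t = \sum_a (t *m (e y)^T) 0 a *: coframe (e y) a.
  rewrite -[LHS](mulmxK (_ : (e y)^T \in unitmx)) ?unitmx_tr ?frame_unit //.
  exact: mulmx_sum_row.
have gammaE (t : 'rV[R]_7) y :
    gamma S y t = \sum_a (t *m (e y)^T) 0 a *: gamma S y (coframe (e y) a).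
  rewrite {1}(coframeE t y) linear_sum /=; apply: eq_bigr => a _.
  by rewrite linearZ.
have hgamma a y : gamma S y (coframe (e y) a) *m u y = u y *m gam a by exact: hgam.
(* Frame representatives: [tau] of the dual of [w], [psi] of the spinor, [N] of the Clifford action.
   Only [tau] varies in [N]. *)
pose tau y := w *m g y *m (e y)^T.
pose psi y := invmx (u y) *m eps y.
pose N y := \sum_a tau y 0 a *: gam a.
have Nu y : gamma S y (flat (g y) w) *m u y = u y *m N y.
  rewrite gammaE mulmx_suml mulmx_sumr; apply: eq_bigr => a _.
  by rewrite -scalemxAl hgamma -scalemxAr.
have Npsi y : N y *m psi y = 0.
  have h : u y *m (N y *m psi y) = 0.
    by rewrite mulmxA -Nu -mulmxA /psi mulKVmx // ann.
  by rewrite -[LHS](mulKmx (uu y)) h mulmx0.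
pose dtau := w *m Dg *m (e x)^T + w *m g x *m De^T.
have htau : mx_derivative (evec R m) x tau dtau.
  have := mx_derivativeM (mx_derivativeM (mx_derivative_cst (evec R m) x w)
    metric_derivative) (mx_derivative_tr he).
  by rewrite mul0mx add0r.
have hN : mx_derivative (evec R m) x N (\sum_a dtau 0 a *: gam a).
  move=> i j; rewrite summxE.
  have -> : (fun y => N y i j) = \sum_a (fun y => tau y 0 a) * (fun=> gam a i j).
    apply/funext => y; rewrite /N summxE fct_sumE; apply: eq_bigr => a _.
    by rewrite mxE.
  apply: is_derive_sum => a; rewrite mxE.
  have -> : dtau 0 a * gam a i j = tau x 0 a *: 0 + gam a i j *: dtau 0 a.
    by rewrite scaler0 add0r mulrC.
  exact: is_deriveM.
have hpsi : mx_derivative (evec R m) x psi (derive_mx (evec R m) psi x).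
  have h := mx_derivativeM (mx_derivative_inv uu (smooth_mx_derivative x m su))
    (smooth_mx_derivative x m seps).
  by rewrite (mx_derivativeE h).
have := mx_derivativeE (mx_derivativeM hN hpsi).
rewrite (_ : (fun y => _) = fun=> 0); last by apply/funext => y; rewrite Npsi.
rewrite (mx_derivativeE (mx_derivative_cst _ _ _)) => /esym/(congr1 (mulmx (u x))).
rewrite mulmx0 mulmxDr !mulmxA -Nu.
have -> : u x *m (\sum_a dtau 0 a *: gam a) *m invmx (u x) *m eps x =
    \sum_a dtau 0 a *: (gamma S x (coframe (e x) a) *m eps x).
  rewrite mulmx_sumr !mulmx_suml; apply: eq_bigr => a _.
  by rewrite -scalemxAr -hgamma -!scalemxAl mulmxK.
(* Parallelism trades the derivative of [psi] for the connection term. *)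
rewrite -[_ *m u x *m _]mulmxA; move/eqP: par; rewrite addr_eq0 => /eqP ->.
(* The components of [w] in the frame, i.e. half the anticommutators of its dual with the
   coframe. *)
pose c := w *m invmx (e x).
rewrite mulmxN -scalemxAr.
rewrite (antisym_clifford_commutator (c := fun a => c 0 a)
   (w := fun a b => conn_form g A e a b (evec R m) x)); first last.
- exact: ann.
- by move=> a b; rewrite !conn_formE frame_connection_antisym.
- move=> a; rewrite addrC gamma_flat_anticomm ?frame_metric_unit //.
  rewrite /vdot /coframe -row_mul [row _ _ 0 0]mxE -trmx_inv -trmx_mul.
  by rewrite mxE.
rewrite -scaler_nat scalerA mulVf ?pnatr_eq0 // scale1r => h.
(* It remains to match the coefficients of each coframe element: w Q e^T = dtau + c
   [frame_connection], which is [frame_derivative] multiplied by [c]. *)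
rewrite gammaE mulmx_suml -[RHS]h -sumrB; apply: eq_bigr => b _.
rewrite -scalemxAl -scalerBl; congr (_ *: _).
have -> : \sum_a c 0 a * conn_form g A e a b (evec R m) x =
    - (c *m frame_connection) 0 b.
  rewrite mxE -sumrN; apply: eq_bigr => a _.
  by rewrite conn_formE frame_connection_antisym mulrN.
rewrite opprK; transitivity ((dtau + c *m frame_connection) 0 b); last by rewrite mxE.
congr (fun_of_matrix _ 0 b).
have wE : w = c *m e x by rewrite /c mulmxKV ?frame_unit.
have := congr1 (mulmx c) frame_derivative.
rewrite mulmx0 !mulmxDr !mulmxA -wE => De0.
rewrite /dtau addrA.
by rewrite -[LHS]add0r -De0; congr (_ + _); rewrite [RHS]addrC addrA.
Qed.

End ParallelSpinor.

(** * The metric in coordinates *)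

Lemma tensor3_evec (R : realType) n (A : 'I_n -> 'M[R]_n) i j k :
  tensor3 A (evec R i) (evec R j) (evec R k) = A i j k.
Proof.
rewrite /tensor3 (bigD1 i) //= big1 => [|l li]; last first.
  by rewrite mxE (negbTE li) andbF mul0r.
rewrite addr0 mxE !eqxx mul1r -rowE mxE (bigD1 k) //= big1 => [|l lk]; last first.
  by rewrite !mxE (negbTE lk) andbF mulr0.
by rewrite !mxE !eqxx mulr1 addr0.
Qed.

Lemma ixE i : ix i = (2 * i)%N :> nat.
Proof. by rewrite inordK //; case: i => [[|[|[|]]]]. Qed.

Lemma iyE i : iy i = (2 * i).+1%N :> nat.
Proof. by rewrite inordK //; case: i => [[|[|[|]]]]. Qed.

Lemma izE : iz = 6%N :> nat.
Proof. by rewrite inordK. Qed.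

Lemma iy_inj : injective iy.
Proof.
move=> i j /(congr1 val) /=; rewrite !iyE => -[] /eqP.
by rewrite eqn_mul2l /= => /eqP/val_inj.
Qed.

Lemma iy_neq_ix i j : iy i != ix j.
Proof.
apply/negP => /eqP/(congr1 val) /=; rewrite iyE ixE => /(congr1 odd).
by rewrite /= !oddM.
Qed.

Lemma iz_neq_ix i : iz != ix i.
Proof. by rewrite -val_eqE /= izE ixE; case: i => [[|[|[|]]]]. Qed.

Lemma iz_neq_iy i : iz != iy i.
Proof. by rewrite -val_eqE /= izE iyE; case: i => [[|[|[|]]]]. Qed.

Lemma coordinateP (a : 'I_7) :
  [\/ exists i, a = ix i, exists i, a = iy i | a = iz].
Proof.
have hx k (lt_k3 : (k < 3)%N) : a = (2 * k)%N :> nat -> exists i, a = ix i.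
  by move=> ak; exists (Ordinal lt_k3); apply: val_inj; rewrite /= ixE.
have hy k (lt_k3 : (k < 3)%N) : a = (2 * k).+1%N :> nat -> exists i, a = iy i.
  by move=> ak; exists (Ordinal lt_k3); apply: val_inj; rewrite /= iyE.
case: a hx hy => [[|[|[|[|[|[|[|//]]]]]]] lt_a7] hx hy.
- by apply: Or31; apply: (hx 0%N).
- by apply: Or32; apply: (hy 0%N).
- by apply: Or31; apply: (hx 1%N).
- by apply: Or32; apply: (hy 1%N).
- by apply: Or31; apply: (hx 2%N).
- by apply: Or32; apply: (hy 2%N).
- by apply: Or33; apply: val_inj; rewrite /= izE.
Qed.

Section Metric.
Variables (R : realType) (H K : 'I_3 -> 'rV[R]_7 -> R) (F : 'rV[R]_7 -> R).
Local Notation g := (metric43 H K F).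

Lemma metric43_tr x : (g x)^T = g x.
Proof.
rewrite /metric43 linearD /= linear_sum /= linearZ /= trmx_delta.
congr (_ + _); apply: eq_bigr => i _.
by rewrite linearD /= !linearZ /= linearD /= !trmx_delta [delta_mx (iy i) _ + _]addrC.
Qed.

Lemma metric43_iy x i a : g x (iy i) a = expR (K i x) * (a == ix i)%:R.
Proof.
rewrite !mxE summxE (bigD1 i) //= big1 => [|j ji]; last first.
  rewrite !mxE (negbTE (iy_neq_ix _ _)) (inj_eq iy_inj) [i == j]eq_sym (negbTE ji).
  by rewrite !(mulr0, addr0).
rewrite !mxE (negbTE (iy_neq_ix _ _)) eqxx [iy i == iz]eq_sym (negbTE (iz_neq_iy _)).
by rewrite !(mulr0, add0r, addr0).
Qed.

Lemma metric43_iz x a : g x iz a = expR (F x) * (a == iz)%:R.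
Proof.
rewrite !mxE summxE big1 => [|j _]; last first.
  by rewrite !mxE (negbTE (iz_neq_ix _)) (negbTE (iz_neq_iy _)) !(mulr0, addr0).
by rewrite eqxx add0r.
Qed.

Lemma flat_metric43_evec x i :
  flat (g x) (evec R (iy i)) = expR (K i x) *: evec R (ix i).
Proof. by apply/rowP => a; rewrite /flat -rowE mxE metric43_iy !mxE. Qed.

Lemma flat_metric43_iy x v i :
  flat (g x) v 0 (iy i) = expR (K i x) * v 0 (ix i).
Proof.
rewrite /flat mxE (bigD1 (ix i)) //= big1 => [|a ai].
  by rewrite -metric43_tr mxE metric43_iy eqxx mulr1 addr0 mulrC.
by rewrite -metric43_tr mxE metric43_iy (negbTE ai) !mulr0.
Qed.

Lemma flat_metric43_iz x v : flat (g x) v 0 iz = expR (F x) * v 0 iz.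
Proof.
rewrite /flat mxE (bigD1 iz) //= big1 => [|a ai].
  by rewrite -metric43_tr mxE metric43_iz eqxx mulr1 addr0 mulrC.
by rewrite -metric43_tr mxE metric43_iz (negbTE ai) !mulr0.
Qed.

(** The hypothesis on the y_k kills the x_k components of v, so that g(v, v) reduces to e^F
    v_z^2. *)
Lemma null_covector_iz x v : (forall k, flat (g x) v 0 (iy k) = 0) ->
  vdot (flat (g x) v) v = 0 -> flat (g x) v 0 iz = 0.
Proof.
move=> vy; have vx k : v 0 (ix k) = 0.
  have /eqP := vy k; rewrite flat_metric43_iy mulf_eq0.
  by rewrite (negbTE (lt0r_neq0 (expR_gt0 _))) => /eqP.
rewrite /vdot mxE (bigD1 iz) //= big1 => [|a az]; last first.
  rewrite [_^T _ _]mxE; case: (coordinateP a) => [[k ->]|[k ->]|ea].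
  - by rewrite vx mulr0.
  - by rewrite vy mul0r.
  - by rewrite ea eqxx in az.
rewrite addr0 [_^T _ _]mxE flat_metric43_iz => /eqP.
by rewrite -mulrA !mulf_eq0 orbb => /orP[]/eqP ->; rewrite ?mul0r ?mulr0.
Qed.

End Metric.

(** * Vanishing of the contorsion components *)

Theorem proposition2p17 (R : realType)
    (H K : 'I_3 -> 'rV[R]_7 -> R) (F : 'rV[R]_7 -> R)
    (hH : forall i, smooth (H i)) (hK : forall i, smooth (K i))
    (hF : smooth F)
    (A : 'rV[R]_7 -> 'I_7 -> 'M[R]_7) (hA : contorsion A)
    (S : spinor_bundle (metric43 H K F))
    (eps : 'rV[R]_7 -> 'cV[R]_8) (heps : smooth_mx eps)
    (eps_isotropic : isotropic S eps)
    (eps_parallel : parallel_spinor A S eps)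
    (eps_triple : associated_triple S eps
       (fun x => expR (K (inord 0) x) *: evec R (ix (inord 0)))
       (fun x => expR (K (inord 1) x) *: evec R (ix (inord 1)))
       (fun x => expR (K (inord 2) x) *: evec R (ix (inord 2)))) :
  forall (x : 'rV[R]_7) (i j k : 'I_3),
    tensor3 (A x) (evec R (iy i)) (evec R (iy j)) (evec R iz) = 0 /\
    tensor3 (A x) (evec R (iy i)) (evec R (iy j)) (evec R (iy k)) = 0.
Proof.
have [e [u [eu par]]] := eps_parallel.
have [mu [_ sq]] := eps_triple.
set o0 : 'I_3 := inord 0 in sq; set o1 : 'I_3 := inord 1 in sq.
set o2 : 'I_3 := inord 2 in sq.
have oE (k : 'I_3) : k \in [:: o0; o1; o2].
  by rewrite !inE -!val_eqE /= !inordK //; case: k => [[|[|[|]]]].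
have [n01 n02 n12] : [/\ o0 != o1, o0 != o2 & o1 != o2].
  by rewrite -!val_eqE /= !inordK.
have g_sym := metric43_tr H K F.
have g_unit y := frame_metric_unit eu y.
have g_null y i j : metric43 H K F y (iy i) (iy j) = 0.
  by rewrite metric43_iy (negbTE (iy_neq_ix _ _)) mulr0.
have g_nullz y i : metric43 H K F y (iy i) iz = 0.
  by rewrite metric43_iy (negbTE (iz_neq_ix _)) mulr0.
have square y := (sq y).2.
move=> x i j k; rewrite !tensor3_evec.
(* The covector nabla_{d_{y_i}} t_j, where t_j is the metric dual of the constant field d_{y_j}. *)
pose s := evec R (iy j) *m koszul (metric43 H K F) A x (iy i).
have s_ann : gamma S x s *m eps x = 0.
  apply: (nabla_annihilates hA eu g_sym heps (par _ _)) => y.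
  have := square y; rewrite -!(flat_metric43_evec H K F) => sqy.
  exact: (square_triple_annihilated (g_sym y) (g_unit y) iy_inj (g_null y)
    n01 n02 n12 sqy).
have := square x; rewrite -!(flat_metric43_evec H K F) => sqx.
have sy l : s 0 (iy l) = 0.
  exact: (annihilator_triple (g_sym x) (g_unit x) iy_inj (g_null x)
    n01 n02 n12 sqx).
have sz : s 0 iz = 0.
  have s_null := annihilator_null (g_sym x) (g_unit x) iy_inj (g_null x)
    n01 n02 n12 sqx s_ann.
  rewrite -(sharpK (g_unit x) s); apply: null_covector_iz => [l|];
    by rewrite (sharpK (g_unit x)).
have partial0 a (f : 'rV[R]_7 -> R) : (forall y, f y = 0) -> partial a f x = 0.
  by move=> f0; rewrite /partial (_ : f = cst 0) ?derive_cst //; apply/funext.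
(* The Koszul terms differentiate g(d_{y_j}, d_b), g(d_{y_i}, d_b) and g(d_{y_i}, d_{y_j}), all
   identically zero when d_b is orthogonal to every d_{y_l}. *)
have sE b : (forall y l, metric43 H K F y (iy l) b = 0) -> s 0 b = A x (iy i) (iy j) b.
  by move=> gb; rewrite /s -rowE !mxE !partial0 // addr0 subr0 mulr0 addr0.
by rewrite -!sE.
Qed.
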